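(* Let $G$ be an $n$-vertex (unweighted, undirected) graph with density $c:=|E(G)|/n^2$. Let $0<\varepsilon_0<1$, and suppose $G$ has an $\varepsilon$-regular $k$-partition $\mathcal{P}=(V_1,\dots,V_k)$ with $\frac1k\le\frac{c}{10}\cdot\frac{\varepsilon_0}{1+\varepsilon_0}$ and $\varepsilon\le(1/k)^{8k^2}$. Then $d_{\mathrm{opt}}(G,G_{/\mathcal{P}})\le\varepsilon_0$.
   Context: Graphs (and weighted graphs) are structures over the signature with one binary symbol $e$: for a graph $G$, $w_G(u,v)=e^{G}(u,v)=1$ if $uv\in E(G)$ and $0$ otherwise; for $U,V\subseteq V(G)$, $w_G(U,V)=\sum_{u\in U}\sum_{v\in V}w_G(u,v)$. For such structures, $\mathrm{opt}(G,H)=\max_{h\colon V(G)\to V(H)}\sum_{(u,v)}w_G(u,v)w_H(h(u),h(v))$ (sum over ordered pairs, maximum over all maps), and $d_{\mathrm{opt}}(G,H)=\sup_{C}|\ln\mathrm{opt}(G,C)-\ln\mathrm{opt}(H,C)|$ over all $\mathbb{Q}_{\ge0}$-weighted structures $C$ on this signature ($\ln0=-\infty$, $|\ln0-\ln0|=0$). A bipartite graph $(V_1,V_2,E)$ with density $d=w(V_1,V_2)/(|V_1||V_2|)$ is $\varepsilon$-homogeneous if for all $W_1\subseteq V_1$, $W_2\subseteq V_2$: $|w(W_1,W_2)-d|W_1||W_2||\le\varepsilon|V_1||V_2|$. An $\varepsilon$-regular $k$-partition of an $n$-vertex graph $G$ is a partition $V_1,\dots,V_k$ of $V(G)$ with $|V_i|\in\{\lfloor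 n/k\rfloor,\lceil n/k\rceil\}$ such that for all $i\ne j$ the bipartite graph between $V_i$ and $V_j$ (with the edges of $G$ between them) is $\varepsilon$-homogeneous. The quotient graph $G_{/\mathcal{P}}$ is the weighted graph on vertex set $[k]$ with weights $w_{G_{/\mathcal{P}}}(i,j)=w_G(V_i,V_j)$ for all $(i,j)\in[k]^2$. *)

(* Defs.v *)
From HB Require Import structures.
From mathcomp Require Import all_boot all_order all_algebra.
From mathcomp Require Import all_classical all_reals all_analysis.
Set Implicit Arguments. Unset Strict Implicit. Unset Printing Implicit Defensive.
Import Order.TTheory GRing.Theory Num.Theory.
Local Open Scope ring_scope.

Section Defs.
Variable R : realType.

Definition simple_graph (n : nat) (e : rel 'I_n) : Prop :=
  (forall u v, e u v = e v u) /\ (forall u, ~~ e u u).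

Definition gweight (n : nat) (e : rel 'I_n) : 'I_n -> 'I_n -> R :=
  fun u v => (e u v)%:R.

Definition wset (T : finType) (w : T -> T -> R) (U V : {set T}) : R :=
  \sum_(u in U) \sum_(v in V) w u v.

Definition num_edges (n : nat) (e : rel 'I_n) : nat :=
  #|[set p : 'I_n * 'I_n | e p.1 p.2 && (p.1 < p.2)%N]|.

Definition density (n : nat) (e : rel 'I_n) : R :=
  (num_edges e)%:R / (n%:R ^+ 2).

Definition opt (A B : finType) (wA : A -> A -> R) (wB : B -> B -> R) : R :=
  \big[Num.max/0]_(h : {ffun A -> B})
     \sum_(u : A) \sum_(v : A) wA u v * wB (h u) (h v).

(* |ln a - ln b| with the conventions ln 0 = -oo and |ln 0 - ln 0| = 0,
   for a, b >= 0 (values of opt are nonnegative). *)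
Definition lndist (a b : R) : \bar R :=
  if (a == 0) && (b == 0) then 0%E
  else if (a == 0) || (b == 0) then +oo%E
  else (`|ln a - ln b|)%:E.

(* d_opt(A,B) = sup over all Q_{>=0}-weighted structures C (on a nonempty
   finite universe, taken w.l.o.g. to be 'I_m.+1) of |ln opt(A,C) - ln opt(B,C)| *)
Definition dopt (A B : finType) (wA : A -> A -> R) (wB : B -> B -> R) : \bar R :=
  ereal_sup [set x : \bar R | exists (m : nat) (wC : 'I_m.+1 -> 'I_m.+1 -> rat),
     (forall i j, 0 <= wC i j) /\
     x = lndist (opt wA (fun i j => ratr (wC i j)))
                (opt wB (fun i j => ratr (wC i j)))].

Definition part (n k : nat) (P : 'I_n -> 'I_k) (i : 'I_k) : {set 'I_n} :=
  [set v | P v == i].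

Definition homogeneous (T : finType) (w : T -> T -> R) (V1 V2 : {set T})
    (eps : R) : Prop :=
  let d := wset w V1 V2 / (#|V1|%:R * #|V2|%:R) in
  forall W1 W2 : {set T}, W1 \subset V1 -> W2 \subset V2 ->
    `|wset w W1 W2 - d * #|W1|%:R * #|W2|%:R| <= eps * #|V1|%:R * #|V2|%:R.

Definition regular_partition (n k : nat) (e : rel 'I_n) (P : 'I_n -> 'I_k)
    (eps : R) : Prop :=
  (forall i : 'I_k, #|part P i| = (n %/ k)%N \/
                    #|part P i| = (n %/ k + ~~ (k %| n))%N) /\
  (forall i j : 'I_k, i != j ->
     homogeneous (gweight e) (part P i) (part P j) eps).

Definition quotient (n k : nat) (e : rel 'I_n) (P : 'I_n -> 'I_k) :
    'I_k -> 'I_k -> R :=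
  fun i j => wset (gweight e) (part P i) (part P j).

End Defs.

(* Main.v *)
Require Import Defs.
From HB Require Import structures.
From mathcomp Require Import all_boot all_order all_algebra.
From mathcomp Require Import all_classical all_reals all_analysis.
From mathcomp Require Import ring lra.
Set Implicit Arguments. Unset Strict Implicit. Unset Printing Implicit Defensive.
Import Order.TTheory GRing.Theory Num.Theory.
Local Open Scope ring_scope.

(** Composing maps on the quotient [Q] with [P] gives [opt Q C <= opt G C]. For the
    converse fix [g : V(G) -> C] and pick [v_i] in [V_i] independently and uniformly.
    Let [X] be the event that [v_a v_b] is an edge for every pair [a < b] of density
    at least [1/k]. Replacing edges by densities one pair at a time, each at cost
    [eps], shows that [P(X)] is close to the product [D] of these densities and that,
    given [X], every dense pair [(v_i, v_j)] is nearly uniform on the edges between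
    [V_i] and [V_j]. Hence the conditional expectation of the value of [i |-> g v_i]
    on [Q] is nearly the value of [g] on [G], up to edges inside parts and in sparse
    pairs. As [D >= (1/k)^(k^2)], all errors are at most about [3 M n^2 / k], with [M] the
    largest weight of [C], while a random cut shows that [opt Q C] is at least about
    [M c n^2 / 2]. If [n < k], some parts may be empty, but then [P] is injective and the
    two optima agree. *)

(** * Expectation over independent coordinates *)

Section ProductExpectation.
Variables (R : realFieldType) (I T : finType) (p : I -> T -> R).
Hypothesis p_ge0 : forall i x, 0 <= p i x.
Hypothesis p_sum1 : forall i, \sum_x p i x = 1.
Implicit Types (v : {ffun I -> T}) (F : {ffun I -> T} -> R).

Definition expect F : R := \sum_(v : {ffun I -> T}) (\prod_i p i (v i)) * F v.

Definition update v i x : {ffun I -> T} := [ffun l => if l == i then x else v l].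

Lemma expect_cst c : expect (fun=> c) = c.
Proof.
rewrite /expect -big_distrl /= -(bigA_distr_bigA p) big1 ?mul1r //.
Qed.

Lemma eq_expect F G : F =1 G -> expect F = expect G.
Proof. by move=> eqFG; apply: eq_bigr => v _; rewrite eqFG. Qed.

Lemma le_expect F G : (forall v, F v <= G v) -> expect F <= expect G.
Proof.
move=> leFG; apply: ler_sum => v _; apply: ler_wpM2l => //.
by apply: prodr_ge0.
Qed.

Lemma expectB F G : expect (fun v => F v - G v) = expect F - expect G.
Proof. by rewrite /expect -sumrB; apply: eq_bigr => v _; rewrite mulrBr. Qed.

Lemma expectZ c F : expect (fun v => c * F v) = c * expect F.
Proof. by rewrite /expect mulr_sumr; apply: eq_bigr => v _; rewrite mulrCA. Qed.

Lemma expect_sum (J : Type) (s : seq J) (Q : pred J) (F : J -> {ffun I -> T} -> R) :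
  expect (fun v => \sum_(j <- s | Q j) F j v) = \sum_(j <- s | Q j) expect (F j).
Proof.
rewrite exchange_big /=; apply: eq_bigr => v _; exact: mulr_sumr.
Qed.

Lemma norm_expect_le F c : (forall v, `|F v| <= c) -> `|expect F| <= c.
Proof.
move=> leF; rewrite ler_norml; apply/andP; split.
  by rewrite -[leLHS]expect_cst; apply: le_expect => v; have := leF v; rewrite ler_norml; lra.
by rewrite -[leRHS]expect_cst; apply: le_expect => v; have := leF v; rewrite ler_norml; lra.
Qed.

(* Exchanging the resampled value with the old one is an involution of pairs
   [(v, x)] that preserves the weight [\prod_l p l (v l) * p i x]. *)
Lemma expect_resample i F :
  expect F = expect (fun v => \sum_x p i x * F (update v i x)).
Proof.
pose sw (q : {ffun I -> T} * T) := (update q.1 i q.2, q.1 i).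
have swK : involutive sw.
  case=> v x; congr pair; last by rewrite /= ffunE eqxx.
  by apply/ffunP => l; rewrite !ffunE; case: eqP => [->|].
pose wt (q : {ffun I -> T} * T) := (\prod_l p l (q.1 l)) * p i q.2.
have wt_sw q : wt (sw q) = wt q.
  case: q => v x; rewrite /wt (bigD1 i) //= [in RHS](bigD1 i) //= ffunE eqxx.
  rewrite (eq_bigr (fun l => p l (v l))) => [|l /negbTE li]; first by ring.
  by rewrite ffunE li.
transitivity (\sum_q wt q * F q.1).
  rewrite -(pair_bigA _ (fun v x => wt (v, x) * F v)) /=.
  apply: eq_bigr => v _; by rewrite -mulr_suml /wt /= -mulr_sumr p_sum1 mulr1.
rewrite (reindex_inj (inv_inj swK)) /=.
rewrite -(pair_bigA _ (fun v x => wt (sw (v, x)) * F (update v i x))) /=.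
apply: eq_bigr => v _; rewrite mulr_sumr; apply: eq_bigr => x _.
by rewrite wt_sw mulrA.
Qed.

Lemma expect_resample2 i j F :
  expect F = expect (fun v => \sum_x \sum_y p i x * p j y *
                               F (update (update v i x) j y)).
Proof.
rewrite (expect_resample j) (expect_resample i); apply: eq_expect => v.
apply: eq_bigr => x _; rewrite mulr_sumr; apply: eq_bigr => y _; exact: mulrA.
Qed.

Lemma expect_pair i j (f : T -> T -> R) : i != j ->
  expect (fun v => f (v i) (v j)) = \sum_x \sum_y p i x * p j y * f x y.
Proof.
move=> /negbTE nij; rewrite (expect_resample2 i j) -[RHS]expect_cst.
apply: eq_expect => v; apply: eq_bigr => x _; apply: eq_bigr => y _.
by rewrite !ffunE eqxx nij eqxx.
Qed.

Definition indep_of i F := forall v x, F (update v i x) = F v.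

Definition unit_valued F := forall v, 0 <= F v <= 1.

(** With all coordinates but [a] and [b] fixed, such an [F] is a function of [v a] times a function
    of [v b], which is what a cut-norm bound can test. *)
Definition splits a b F := exists A B : {ffun I -> T} -> R,
  [/\ unit_valued A /\ unit_valued B, indep_of b A, indep_of a B &
      forall v, F v = A v * B v].

Lemma splitsM a b F G : splits a b F -> splits a b G ->
  splits a b (fun v => F v * G v).
Proof.
move=> [A [B [[uA uB] iA iB FE]]] [A' [B' [[uA' uB'] iA' iB' GE]]].
exists (fun v => A v * A' v), (fun v => B v * B' v); split.
- split=> v; have /andP[a0 a1] := uA v; have /andP[a0' a1'] := uA' v;
  have /andP[b0 b1] := uB v; have /andP[b0' b1'] := uB' v;
  by rewrite mulr_ge0 //= mulr_ile1.
- by move=> v x; rewrite iA iA'.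
- by move=> v x; rewrite iB iB'.
- by move=> v; rewrite FE GE mulrACA.
Qed.

Lemma splits1 a b : splits a b (fun=> 1).
Proof.
exists (fun=> 1), (fun=> 1); split=> //; last by move=> v; rewrite mulr1.
by split=> v; rewrite ler01 lexx.
Qed.

(** A pair other than [{a, b}] misses [a] or [b], so [f] can be one of the two factors and 1 the
    other. *)
Lemma splits_pair a b i j (f : T -> T -> R) : a != b ->
  ~~ ((i == a) && (j == b)) -> ~~ ((i == b) && (j == a)) -> i != j ->
  (forall x y, 0 <= f x y <= 1) ->
  splits a b (fun v => f (v i) (v j)).
Proof.
move=> nab nij nji ij uf.
have u1 : unit_valued (fun=> 1) by move=> v; rewrite ler01 lexx.
have uF : unit_valued (fun v => f (v i) (v j)) by move=> v.
have [nb|] := boolP ((i != b) && (j != b)).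
  exists (fun v => f (v i) (v j)), (fun=> 1); split=> // [v x|v]; last by rewrite mulr1.
  by case/andP: nb => /negbTE ib /negbTE jb; rewrite !ffunE ib jb.
rewrite negb_and !negbK => bij.
(* A pair that contains [b] and is not [{a, b}] avoids [a]. *)
have /andP[/negbTE ia /negbTE ja] : (i != a) && (j != a).
  case/orP: bij => /eqP eb; rewrite eb in nab nij nji ij *.
    by move: nji; rewrite eqxx /= => ->; rewrite eq_sym nab.
  by move: nij; rewrite eqxx andbT => ->; rewrite eq_sym nab.
exists (fun=> 1), (fun v => f (v i) (v j)); split=> // [v x|v]; last by rewrite mul1r.
by rewrite !ffunE ia ja.
Qed.

(** * Counting lemma: replacing edges by densities *)

Section Counting.
Variables (w : T -> T -> R) (d : I -> I -> R) (eps : R).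
Hypothesis w_unit : forall x y, 0 <= w x y <= 1.

(** Closeness in cut norm, tested on functions into the unit interval instead of sets, since these
    are what [splits] provides. *)
Definition cut_close a b := forall A B : T -> R,
  (forall x, 0 <= A x <= 1) -> (forall y, 0 <= B y <= 1) ->
  `|\sum_x \sum_y p a x * p b y * ((w x y - d a b) * (A x * B y))| <= eps.

(** Resampling only [a] and [b] turns the expectation into an average, over the other coordinates,
    of sums that [cut_close] bounds one by one. *)
Lemma replace_edge a b F : a != b -> cut_close a b -> splits a b F ->
  `|expect (fun v => (w (v a) (v b) - d a b) * F v)| <= eps.
Proof.
move=> nab cab [A [B [[uA uB] iA iB FE]]].
rewrite (expect_resample2 a b); apply: norm_expect_le => v.
have -> : \sum_x \sum_y p a x * p b y *
   ((w (update (update v a x) b y a) (update (update v a x) b y b) - d a b) *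
      F (update (update v a x) b y)) =
  \sum_x \sum_y p a x * p b y * ((w x y - d a b) *
    (A (update v a x) * B (update v b y))).
  apply: eq_bigr => x _; apply: eq_bigr => y _; rewrite FE iA.
  (* Once the updates are swapped, the outer one is at [a], on which [B] does not depend. *)
  have -> : update (update v a x) b y = update (update v b y) a x.
    apply/ffunP => l; rewrite !ffunE; case: eqP => [->|//].
    by rewrite eq_sym (negbTE nab).
  by rewrite iB !ffunE eqxx (eq_sym b a) (negbTE nab) eqxx.
by apply: cab.
Qed.

Definition edge_prod (s : seq (I * I)) v := \prod_(q <- s) w (v q.1) (v q.2).
Definition dens_prod (s : seq (I * I)) := \prod_(q <- s) d q.1 q.2.

Lemma edge_prod_unit s : unit_valued (edge_prod s).
Proof.
move=> v; rewrite prodr_ge0 /=; last by move=> q _; case/andP: (w_unit (v q.1) (v q.2)).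
by apply: prodr_ile1 => q _.
Qed.

(** Distinctness as unordered pairs, the condition under which [splits_pair] applies. *)
Definition distinct_pairs (q r : I * I) :=
  ~~ ((q.1 == r.1) && (q.2 == r.2)) && ~~ ((q.1 == r.2) && (q.2 == r.1)).

Variable E : pred (I * I).
Hypothesis E_irr : forall q, E q -> q.1 != q.2.
Hypothesis E_dens : forall q, E q -> 0 <= d q.1 q.2 <= 1.
Hypothesis E_close : forall q, E q -> cut_close q.1 q.2.
Hypothesis E_distinct : forall q r, E q -> E r -> q != r -> distinct_pairs q r.

Lemma splits_edge_prod q s : E q -> all E s -> q \notin s ->
  splits q.1 q.2 (edge_prod s).
Proof.
move=> Eq; elim: s => [_ _|r s IHs /= /andP[Er Es]].
  have [A [B [u iA iB FE]]] := splits1 q.1 q.2.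
  by exists A, B; split=> // v; rewrite /edge_prod big_nil -FE.
rewrite inE negb_or => /andP[qr qs].
have /andP[d1 d2] := E_distinct Eq Er qr.
have := splitsM (@splits_pair q.1 q.2 r.1 r.2 w (E_irr Eq) _ _ (E_irr Er) w_unit)
          (IHs Es qs).
move=> /(_ _ _)[||A [B [u iA iB FE]]].
- by rewrite (eq_sym r.1) (eq_sym r.2).
- by rewrite (eq_sym r.1) (eq_sym r.2) andbC.
by exists A, B; split=> // v; rewrite /edge_prod big_cons -FE.
Qed.

(** Telescoping: the head edge is replaced with [F] times the remaining edges as the splitting
    function, and the induction bound survives multiplication by a density of at most 1. *)
Lemma counting_lemma s F : all E s -> uniq s ->
  (forall q, q \in s -> splits q.1 q.2 F) ->
  `|expect (fun v => F v * edge_prod s v) - dens_prod s * expect F|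
    <= (size s)%:R * eps.
Proof.
elim: s => [|q s IHs] => [_ _ _|/= /andP[Eq Es] /andP[qs us] sF].
  rewrite /edge_prod /dens_prod big_nil mul1r mul0r -expectB.
  rewrite (eq_expect (G := fun=> 0)) ?expect_cst ?normr0 // => v.
  by rewrite big_nil mulr1 subrr.
have /andP[dq0 dq1] := E_dens Eq.
have IH := IHs Es us (fun r rs => sF r (mem_behead (s := q :: s) rs)).
have := splitsM (sF q (mem_head _ _)) (splits_edge_prod Eq Es qs).
move/(replace_edge (E_irr Eq) (E_close Eq)).
rewrite (eq_expect (G := fun v => F v * edge_prod (q :: s) v -
            d q.1 q.2 * (F v * edge_prod s v))); last first.
  by move=> v; rewrite /edge_prod big_cons; ring.
rewrite expectB expectZ => step.
have {}IH : `|d q.1 q.2 * (expect (fun v => F v * edge_prod s v)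
               - dens_prod s * expect F)| <= (size s)%:R * eps.
  rewrite normrM ger0_norm //; apply: le_trans IH.
  by rewrite -[leRHS]mul1r ler_wpM2r.
rewrite [dens_prod (q :: s)]big_cons -/(dens_prod s).
rewrite -natr1 mulrDl mul1r [leRHS]addrC.
apply: le_trans (le_trans (ler_normD _ _) (lerD step IH)).
by rewrite le_eqVlt; apply/orP; left; apply/eqP; congr `|_|; ring.
Qed.

(* [f] and the edge [q] itself are kept; only the other pairs, each of which
   shares at most one coordinate with [q], are replaced by their densities. *)
Lemma counting_lemma_edge s q (f : T -> T -> R) : all E s -> uniq s -> q \in s ->
  (forall x y, 0 <= f x y <= 1) ->
  `|d q.1 q.2 * expect (fun v => f (v q.1) (v q.2) * edge_prod s v)
    - dens_prod s * expect (fun v => f (v q.1) (v q.2) * w (v q.1) (v q.2))|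
    <= (size s)%:R * eps.
Proof.
move=> Es us qs uf; have Eq := allP Es q qs.
have /andP[dq0 dq1] := E_dens Eq.
(* Zero test functions in [cut_close] show this; it lets the count grow from [size (rem q s)] to
   [size s] at the end. *)
have eps0 : 0 <= eps.
  have u0 (x : T) : (0 : R) <= (0 : R) <= (1 : R) by rewrite lexx ler01.
  by have := @E_close _ Eq (fun=> 0) (fun=> 0) u0 u0; apply: le_trans.
have Es' : all E (rem q s) by apply/allP => r /mem_rem /(allP Es).
have us' := rem_uniq q us.
have ufw x y : 0 <= f x y * w x y <= 1.
  have /andP[f0 f1] := uf x y; have /andP[w0 w1] := w_unit x y.
  by rewrite mulr_ge0 //= mulr_ile1.
have sp r : r \in rem q s ->
    splits r.1 r.2 (fun v => f (v q.1) (v q.2) * w (v q.1) (v q.2)).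
  rewrite mem_rem_uniq // => /andP[/= rq rs].
  have Er := allP Es r rs.
  rewrite eq_sym in rq.
  have /andP[d1 d2] := E_distinct Eq Er rq.
  exact: (splits_pair (f := fun x y => f x y * w x y) (E_irr Er) d1 d2 (E_irr Eq) ufw).
have := counting_lemma Es' us' sp.
rewrite (eq_expect (G := fun v => f (v q.1) (v q.2) * edge_prod s v)); last first.
  by move=> v; rewrite /edge_prod (perm_big _ (perm_to_rem qs)) big_cons mulrA.
have -> : dens_prod s = d q.1 q.2 * dens_prod (rem q s).
  by rewrite /dens_prod (perm_big _ (perm_to_rem qs)) big_cons.
move=> le1; rewrite -mulrA -mulrBr normrM ger0_norm //.
apply: le_trans (_ : _ <= (size (rem q s))%:R * eps) _.
  by apply: le_trans le1; rewrite -[leRHS]mul1r ler_wpM2r.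
by rewrite ler_wpM2r // ler_nat size_rem // leq_pred.
Qed.

End Counting.
End ProductExpectation.

(** * From sets to functions in the cut norm *)

Section CutNorm.
Variables (R : realFieldType) (T : finType).
Implicit Types V : {set T}.

(** A linear form on a cube is largest at the vertex that selects its positive coefficients. *)
Lemma sum_unit_le (V : {set T}) (c A : T -> R) : (forall x, 0 <= A x <= 1) ->
  \sum_(x in V) c x * A x <= \sum_(x in [set x in V | 0 < c x]) c x.
Proof.
move=> uA; rewrite big_mkcond [leRHS]big_mkcond; apply: ler_sum => x _.
rewrite inE; case: (x \in V) => //=; have /andP[A0 A1] := uA x.
by case: ltP => c0; nra.
Qed.

(** The form is linear in [A] and in [B] separately, so each can be rounded to the indicator of a
    set without decreasing the value. *)
Lemma cut_bilinear_le (K : T -> T -> R) (V1 V2 : {set T}) (c : R) :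
  (forall W1 W2 : {set T}, W1 \subset V1 -> W2 \subset V2 ->
     \sum_(x in W1) \sum_(y in W2) K x y <= c) ->
  forall A B : T -> R,
  (forall x, 0 <= A x <= 1) -> (forall y, 0 <= B y <= 1) ->
  \sum_(x in V1) \sum_(y in V2) K x y * (A x * B y) <= c.
Proof.
move=> cutK A B uA uB.
rewrite (eq_bigr (fun x => (\sum_(y in V2) K x y * B y) * A x)); last first.
  by move=> x _; rewrite mulr_suml; apply: eq_bigr => y _; ring.
apply: le_trans (sum_unit_le _ _ uA) _; rewrite exchange_big /=.
under eq_bigr do rewrite -mulr_suml.
apply: le_trans (sum_unit_le _ _ uB) _; rewrite exchange_big /=.
by apply: cutK; apply/fintype.subsetP => x; rewrite inE => /andP[].
Qed.

(** For empty [V] this is 0 and not a probability, whence the later care for nonempty parts. *)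
Definition uniform (V : {set T}) (x : T) : R := (x \in V)%:R / #|V|%:R.

Lemma uniform_ge0 V x : 0 <= uniform V x.
Proof. by rewrite divr_ge0 ?ler0n. Qed.

Lemma sum_uniform V (F : T -> R) :
  \sum_x uniform V x * F x = (\sum_(x in V) F x) / #|V|%:R.
Proof.
rewrite mulr_suml [RHS]big_mkcond; apply: eq_bigr => x _; rewrite /uniform.
by case: (x \in V); rewrite ?mul0r // mul1r mulrC.
Qed.

Lemma sum_uniform1 V : (0 < #|V|)%N -> \sum_x uniform V x = 1.
Proof.
move=> V0; under eq_bigr do rewrite -[uniform V _]mulr1.
rewrite sum_uniform sumr_const -[1 *+ _]/(_%:R) divff // pnatr_eq0 -lt0n //.
Qed.

Lemma sum_uniform2 V1 V2 (F : T -> T -> R) :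
  \sum_x \sum_y uniform V1 x * uniform V2 y * F x y =
  (\sum_(x in V1) \sum_(y in V2) F x y) / (#|V1|%:R * #|V2|%:R).
Proof.
under eq_bigr => x _.
  under eq_bigr do rewrite -mulrA.
  rewrite -mulr_sumr sum_uniform; over.
by rewrite sum_uniform -mulr_suml invfM mulrA mulrAC.
Qed.

End CutNorm.

Section Opt.
Variable R : realType.

Lemma homogeneous_cut_close (n k : nat) (w : 'I_n -> 'I_n -> R) (V : 'I_k -> {set 'I_n})
    (d : 'I_k -> 'I_k -> R) (eps : R) (a b : 'I_k) :
  (0 < #|V a|)%N -> (0 < #|V b|)%N ->
  d a b = wset w (V a) (V b) / (#|V a|%:R * #|V b|%:R) ->
  homogeneous w (V a) (V b) eps ->
  cut_close (fun i => uniform R (V i)) w d eps a b.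
Proof.
move=> Va Vb dE hom A B uA uB; rewrite sum_uniform2.
have sE : (#|V a|%:R * #|V b|%:R : R) > 0 by rewrite mulr_gt0 ?ltr0n.
rewrite normrM normfV (gtr0_norm sE) ler_pdivrMr // mulrA.
have cut (W1 W2 : {set 'I_n}) : W1 \subset V a -> W2 \subset V b ->
  `|\sum_(x in W1) \sum_(y in W2) (w x y - d a b)| <= eps * #|V a|%:R * #|V b|%:R.
  move=> s1 s2; have := hom W1 W2 s1 s2; rewrite -dE; congr (`|_| <= _).
  under [RHS]eq_bigr do rewrite sumrB sumr_const.
  by rewrite sumrB sumr_const -mulrnA -[_ *+ (_ * _)]mulr_natr mulnC natrM mulrA.
rewrite ler_norml; apply/andP; split.
  (* The lower bound is the upper bound for the negated kernel. *)
  rewrite lerNl -sumrN.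
  rewrite (eq_bigr (fun x => \sum_(y in V b) (- (w x y - d a b)) * (A x * B y))).
    apply: cut_bilinear_le => // W1 W2 s1 s2.
    under eq_bigr do rewrite sumrN.
    by rewrite sumrN lerNl; have := cut _ _ s1 s2; rewrite ler_norml => /andP[].
  by move=> x _; rewrite -sumrN; apply: eq_bigr => y _; rewrite mulNr.
apply: cut_bilinear_le => // W1 W2 s1 s2.
by have := cut _ _ s1 s2; rewrite ler_norml => /andP[].
Qed.

(** * Elementary bounds on [opt] *)

Section OptGeneral.
Variables (A B : finType) (wA : A -> A -> R) (wB : B -> B -> R).

Lemma le_opt (h : A -> B) :
  \sum_u \sum_v wA u v * wB (h u) (h v) <= opt wA wB.
Proof.
have := le_bigmax 0 (fun h : {ffun A -> B} =>
  \sum_u \sum_v wA u v * wB (h u) (h v)) (finfun h).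
apply: le_trans; rewrite le_eqVlt; apply/orP; left; apply/eqP.
by apply: eq_bigr => u _; apply: eq_bigr => v _; rewrite !ffunE.
Qed.

Lemma opt_ge0 : 0 <= opt wA wB.
Proof. exact: bigmax_ge_id. Qed.

Lemma opt_le x : 0 <= x ->
  (forall h : A -> B, \sum_u \sum_v wA u v * wB (h u) (h v) <= x) ->
  opt wA wB <= x.
Proof. by move=> x0 le_x; apply: bigmax_le => // h _. Qed.

(* A uniformly random map to [{a, b}] sends an off-diagonal pair to [(a, b)]
   with probability 1/4 (or more, when [a = b]). *)
Lemma opt_ge_cut a b : (forall u v, 0 <= wA u v) -> (forall u v, 0 <= wB u v) ->
  wB a b * (\sum_u \sum_(v | u != v) wA u v) <= 4 * opt wA wB.
Proof.
move=> wA0 wB0; pose p (_ : A) (_ : bool) : R := 2^-1.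
have p0 i x : 0 <= p i x by rewrite invr_ge0 ler0n.
have p1 i : \sum_x p i x = 1 by rewrite big_bool /p /=; lra.
pose c (x : bool) := if x then a else b.
rewrite -ler_pdivrMl //.
have := le_expect p0 (F := fun s => \sum_u \sum_v wA u v * wB (c (s u)) (c (s v)))
  (fun s => le_opt (fun u => c (s u))).
rewrite expect_cst //; apply: le_trans; rewrite expect_sum mulrA mulr_sumr.
apply: ler_sum => u _; rewrite expect_sum mulr_sumr big_mkcond; apply: ler_sum => v _.
case: ifP => uv.
  rewrite expectZ (expect_pair p1 (fun x y => wB (c x) (c y)) uv) mulrC.
  apply: ler_wpM2l => //; rewrite !big_bool /p /=.
  (* Of the four outcomes, each of weight 1/4, only the one giving [wB a b] is kept. *)
  by have := wB0 a a; have := wB0 b a; have := wB0 b b; have := wB0 a b; lra.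
by rewrite -(expect_cst p1 0); apply: le_expect => // s; apply: mulr_ge0.
Qed.
End OptGeneral.
End Opt.

(** * Partitions, quotient weights and densities *)

Section Partition.
Variables (R : realType) (n k : nat) (e : rel 'I_n) (P : 'I_n -> 'I_k).
Hypothesis e_simple : simple_graph e.
Local Notation w := (gweight R e).
Local Notation Q := (quotient R e P).
Local Notation V := (part P).
Local Notation sz i := (#|V i|%:R : R).

Definition pair_density (i j : 'I_k) : R := Q i j / (sz i * sz j).
Local Notation d := pair_density.

Lemma gweight_unit x y : 0 <= w x y <= 1.
Proof. by rewrite /gweight; case: (e x y); rewrite lexx ler01. Qed.

Lemma gweight_sym x y : w x y = w y x.
Proof. by rewrite /gweight e_simple.1. Qed.

Lemma sum_part (F : 'I_n -> R) : \sum_u F u = \sum_i \sum_(u in V i) F u.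
Proof.
rewrite (partition_big P predT) //=; apply: eq_bigr => i _.
by apply: eq_bigl => u; rewrite inE.
Qed.

Lemma sum_part2 (F : 'I_n -> 'I_n -> R) :
  \sum_u \sum_v F u v = \sum_i \sum_j \sum_(u in V i) \sum_(v in V j) F u v.
Proof.
rewrite sum_part; apply: eq_bigr => i _; rewrite [RHS]exchange_big /=.
by apply: eq_bigr => u _; apply: sum_part.
Qed.

Lemma sum_part_card : \sum_i sz i = n%:R.
Proof.
transitivity (\sum_(u < n) 1 : R); last by rewrite sumr_const card_ord.
by rewrite sum_part; apply: eq_bigr => i _; rewrite sumr_const.
Qed.

Lemma sum_part_card2 : \sum_i \sum_j sz i * sz j = n%:R ^+ 2.
Proof.
under eq_bigr do rewrite -mulr_sumr sum_part_card.
by rewrite -mulr_suml sum_part_card expr2.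
Qed.

Lemma quotient_pullback (f : 'I_k -> 'I_k -> R) :
  \sum_i \sum_j Q i j * f i j = \sum_u \sum_v w u v * f (P u) (P v).
Proof.
rewrite sum_part2; apply: eq_bigr => i _; apply: eq_bigr => j _.
rewrite mulr_suml; apply: eq_bigr => u; rewrite inE => /eqP ->.
by rewrite mulr_suml; apply: eq_bigr => v; rewrite inE => /eqP ->.
Qed.

Lemma sum_quotient : \sum_i \sum_j Q i j = \sum_u \sum_v w u v.
Proof. by rewrite sum_part2. Qed.

Lemma quotient_sym i j : Q i j = Q j i.
Proof.
rewrite /quotient /wset exchange_big; apply: eq_bigr => v _.
by apply: eq_bigr => u _; apply: gweight_sym.
Qed.

Lemma quotient_ge0 i j : 0 <= Q i j.
Proof. by apply: sumr_ge0 => u _; apply: sumr_ge0 => v _; case/andP: (gweight_unit u v). Qed.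

Lemma weighted_pair_le i j (f : 'I_n -> 'I_n -> R) : (forall x y, 0 <= f x y <= 1) ->
  \sum_(u in V i) \sum_(v in V j) f u v * w u v <= Q i j.
Proof.
move=> uf; apply: ler_sum => u _; apply: ler_sum => v _.
have /andP[f0 f1] := uf u v; have /andP[w0 w1] := gweight_unit u v.
by rewrite -[leRHS]mul1r ler_wpM2r.
Qed.

Lemma quotient_le i j : Q i j <= sz i * sz j.
Proof.
apply: le_trans (_ : _ <= \sum_(u in V i) \sum_(v in V j) (1 : R)) _.
  by apply: ler_sum => u _; apply: ler_sum => v _; case/andP: (gweight_unit u v).
under eq_bigr do rewrite sumr_const.
by rewrite sumr_const -mulrnA mulnC -natrM.
Qed.

Lemma pair_density_sym i j : d i j = d j i.
Proof. by rewrite /pair_density quotient_sym [sz i * _]mulrC. Qed.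

(** Each edge is counted in both orders on the left and once in [num_edges]. *)
Lemma sum_gweight : \sum_u \sum_v w u v = 2 * density R e * n%:R ^+ 2.
Proof.
have -> : 2 * density R e * n%:R ^+ 2 = 2 * (num_edges e)%:R :> R.
  have [n0|n0] := posnP n.
    have /eqP e0 : num_edges e == 0%N.
      by rewrite -leqn0 (leq_trans (max_card _)) // card_prod card_ord n0.
    by rewrite /density e0 !mul0r mulr0 mul0r.
  rewrite -mulrA divfK // expf_neq0 // pnatr_eq0 -lt0n //.
have nE : (num_edges e)%:R = \sum_u \sum_v (e u v && (u < v)%N)%:R :> R.
  rewrite (pair_bigA _ (fun u v => (e u v && (u < v)%N)%:R : R)) /=.
  rewrite /num_edges -sum1dep_card natr_sum big_mkcond /=.
  by apply: eq_bigr => q _; case: (_ && _).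
rewrite mulr_natl mulr2n nE [X in _ = _ + X]exchange_big -big_split /=.
apply: eq_bigr => u _; rewrite -big_split /=; apply: eq_bigr => v _.
rewrite /gweight (e_simple.1 v u); case: ltngtP => uv; rewrite ?andbT ?andbF ?addr0 ?add0r //.
by rewrite (val_inj uv) (negbTE (e_simple.2 v)).
Qed.

(** * Random transversals of a regular partition *)

Section Equitable.
Variable eps : R.
Hypothesis P_reg : regular_partition e P eps.
Hypothesis k_gt0 : (0 < k)%N.
Hypothesis k_le_n : (k <= n)%N.
Local Notation kappa := (k%:R^-1 : R).

Lemma part_gt0 i : (0 < #|V i|)%N.
Proof.
have nk : (0 < n %/ k)%N by rewrite divn_gt0.
by case: (P_reg.1 i) => ->; rewrite ?addn_gt0 nk.
Qed.

Lemma part_card_le i : sz i <= 2 * kappa * n%:R.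
Proof.
have : (#|V i| * k <= 2 * n)%N.
  have nk : (0 < n %/ k)%N by rewrite divn_gt0.
  have le_n : (n %/ k * k <= n)%N by apply: leq_trunc_div.
  (* Rounding up adds at most 1, which is at most [n %/ k] because [k <= n]. *)
  have le2 : (#|V i| <= 2 * (n %/ k))%N.
    rewrite mul2n -addnn; case: (P_reg.1 i) => ->; first exact: leq_addr.
    by rewrite leq_add2l; apply: leq_trans nk; case: (~~ _).
  by apply: leq_trans (_ : 2 * (n %/ k) * k <= _)%N; rewrite ?leq_mul2r ?le2 ?orbT // -mulnA leq_mul2l.
rewrite -(ler_nat R) !natrM => le2.
by rewrite mulrAC ler_pdivlMr // ltr0n.
Qed.

(** This bounds the total weight inside the parts. *)
Lemma sum_sqr_part_card : \sum_i sz i ^+ 2 <= 2 * kappa * n%:R ^+ 2.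
Proof.
rewrite [n%:R ^+ 2]expr2 mulrA -{2}sum_part_card mulr_sumr; apply: ler_sum => i _.
by rewrite expr2 ler_wpM2r ?part_card_le.
Qed.

Lemma sz_gt0 i j : 0 < sz i * sz j.
Proof. by rewrite mulr_gt0 ?ltr0n ?part_gt0. Qed.

Lemma quotientE i j : Q i j = sz i * sz j * d i j.
Proof. by rewrite /pair_density mulrC divfK // gt_eqF ?sz_gt0. Qed.

Lemma pair_density_unit i j : 0 <= d i j <= 1.
Proof.
rewrite divr_ge0 ?quotient_ge0 ?(ltW (sz_gt0 i j)) //=.
by rewrite ler_pdivrMr ?sz_gt0 // mul1r quotient_le.
Qed.

Local Notation p := (fun i => uniform R (V i)).

(** The order lists each unordered pair once, as the counting lemma requires; the threshold keeps
    the product [D] away from 0. *)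
Definition dense_pair (q : 'I_k * 'I_k) : bool := (q.1 < q.2)%N && (kappa <= d q.1 q.2).

Local Notation S := (enum dense_pair).
Local Notation X := (edge_prod w S).
Local Notation D := (dens_prod d S).
Local Notation err := ((size S)%:R * eps).

Lemma dense_pair_neq q : dense_pair q -> q.1 != q.2.
Proof. by case/andP=> lt_q _; apply: contraTneq lt_q => ->; rewrite ltnn. Qed.

Lemma dense_pair_distinct q r : dense_pair q -> dense_pair r -> q != r ->
  distinct_pairs q r.
Proof.
case: q r => [a b] [a' b'] /andP[/= ab _] /andP[/= ab' _].
rewrite /distinct_pairs xpair_eqE => -> /=.
by apply/negP => /andP[/eqP aE /eqP bE]; move: ab; rewrite aE bE ltnNge (ltnW ab').
Qed.

Lemma dense_pair_close q : dense_pair q -> cut_close p w d eps q.1 q.2.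
Proof.
move=> /dense_pair_neq nq.
by apply: homogeneous_cut_close; rewrite ?part_gt0 //; apply: P_reg.2.
Qed.

Lemma all_dense : all dense_pair S.
Proof. by apply/allP => q; rewrite mem_enum. Qed.

Lemma sum_uniform_part i : \sum_x p i x = 1.
Proof. by rewrite sum_uniform1 ?part_gt0. Qed.

Lemma uniform_part_ge0 i x : 0 <= p i x.
Proof. exact: uniform_ge0. Qed.

Lemma expect_edge_prod_le : expect p X <= D + err.
Proof.
have := counting_lemma uniform_part_ge0 sum_uniform_part gweight_unit dense_pair_neq
  (fun q _ => pair_density_unit q.1 q.2) dense_pair_close dense_pair_distinct
  all_dense (enum_uniq _) (F := fun=> 1) (fun q _ => splits1 _ _ _ _).
rewrite expect_cst; last exact: sum_uniform_part.
rewrite (eq_expect p (G := X)) => [|v]; last by rewrite mul1r.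
by rewrite ler_norml mulr1; lra.
Qed.

(** One side of [counting_lemma_edge], scaled by [sz i * sz j] to pass from densities to weights. *)
Lemma dense_edge_lt (i j : 'I_k) (f : 'I_n -> 'I_n -> R) : (i < j)%N -> kappa <= d i j ->
  (forall x y, 0 <= f x y <= 1) ->
  D * (\sum_(x in V i) \sum_(y in V j) f x y * w x y) - sz i * sz j * err <=
    Q i j * expect p (fun v => f (v i) (v j) * X v).
Proof.
move=> ij dij uf; have Eij : dense_pair (i, j) by rewrite /dense_pair /= ij.
have Sij : (i, j) \in S by rewrite mem_enum.
have := counting_lemma_edge uniform_part_ge0 sum_uniform_part gweight_unit dense_pair_neq
  (fun q _ => pair_density_unit q.1 q.2) dense_pair_close dense_pair_distinct
  all_dense (enum_uniq _) Sij uf.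
rewrite (expect_pair sum_uniform_part (fun x y => f x y * w x y) (dense_pair_neq Eij)) sum_uniform2 /=.
set Y := expect _ _; set B := (\sum_(x in _) _); rewrite ler_norml => /andP[le1 _].
have {le1} : D * (B / (sz i * sz j)) - err <= d i j * Y by lra.
rewrite -(ler_pM2l (sz_gt0 i j)); congr (_ <= _); last by rewrite quotientE mulrA.
by rewrite mulrBr mulrCA [_ * (B / _)]mulrC divfK // gt_eqF ?sz_gt0.
Qed.

Lemma dense_edge i j (f : 'I_n -> 'I_n -> R) : i != j -> kappa <= d i j ->
  (forall x y, 0 <= f x y <= 1) ->
  D * (\sum_(x in V i) \sum_(y in V j) f x y * w x y) - sz i * sz j * err <=
    Q i j * expect p (fun v => f (v i) (v j) * X v).
Proof.
move=> nij dij uf; have [lt|ge] := ltnP i j; first exact: dense_edge_lt.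
have lt : (j < i)%N by rewrite ltn_neqAle ge andbT eq_sym.
have := dense_edge_lt (f := fun x y => f y x) lt _ (fun x y => uf y x).
rewrite pair_density_sym => /(_ dij); rewrite exchange_big quotient_sym [sz j * _]mulrC /=.
under eq_bigr do under eq_bigr do rewrite gweight_sym.
by [].
Qed.

Hypothesis eps_small : eps <= kappa ^+ (8 * k ^ 2).
Hypothesis eps_gt0 : 0 < eps.

Lemma kappa_gt0 : 0 < kappa.
Proof. by rewrite invr_gt0 ltr0n. Qed.

Lemma kappa_le1 : kappa <= 1.
Proof. by rewrite invf_le1 ?ltr0n // ler1n. Qed.

Lemma size_dense : (size S <= k ^ 2)%N.
Proof.
rewrite -cardE (leq_trans (max_card _)) // card_prod card_ord -mulnn //.
Qed.

Lemma dens_prod_ge : kappa ^+ (k ^ 2) <= D.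
Proof.
apply: le_trans (_ : kappa ^+ size S <= _).
  rewrite ler_wiXn2l ?size_dense ?kappa_le1 ?(ltW kappa_gt0) //.
have -> : kappa ^+ size S = \prod_(q <- S) kappa.
  by rewrite big_const_seq count_predT iter_mulr_1.
rewrite /dens_prod !big_enum; apply: ler_prod => q /andP[_ dq].
by rewrite (ltW kappa_gt0).
Qed.

Lemma dens_prod_gt0 : 0 < D.
Proof. by apply: lt_le_trans dens_prod_ge; rewrite exprn_gt0 ?kappa_gt0. Qed.

Lemma err_le : err <= D * kappa ^+ 2.
Proof.
have k0 := kappa_gt0; have k1 := kappa_le1.
apply: le_trans (_ : (k ^ 2)%:R * kappa ^+ (8 * k ^ 2) <= _).
  by apply: ler_pM; rewrite ?ler0n ?(ltW eps_gt0) // ler_nat size_dense.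
apply: le_trans (_ : kappa ^+ (k ^ 2) * kappa ^+ 2 <= _); last first.
  by rewrite ler_wpM2r ?dens_prod_ge // exprn_ge0 // ltW.
(* In powers of [kappa] the claim becomes [k ^ 2 + 4 <= 8 * k ^ 2]. *)
have -> : (k ^ 2)%:R = (kappa ^+ 2)^-1 by rewrite natrX exprVn invrK.
rewrite mulrC ler_pdivrMr ?exprn_gt0 // -!exprD ler_wiXn2l ?(ltW k0) //.
have : (0 < k ^ 2)%N by rewrite expn_gt0 k_gt0.
by rewrite mulSn; case: (k ^ 2)%N => // m _; rewrite -addnA leq_add2l (leq_trans _ (leq_pmulr _ _)).
Qed.

(* A random transversal conditioned on spanning all dense pairs sees each dense
   pair as a nearly uniform random edge of [G], so the average over it of the
   value on the quotient recovers the value on [G]. *)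
Lemma sum_gweight_le_transversal (f : 'I_n -> 'I_n -> R) (O : R) :
  (forall x y, 0 <= f x y <= 1) -> 0 <= O ->
  (forall v : 'I_k -> 'I_n, \sum_i \sum_j Q i j * f (v i) (v j) <= O) ->
  \sum_x \sum_y f x y * w x y <=
    O + (O + n%:R ^+ 2) * kappa ^+ 2 + 3 * kappa * n%:R ^+ 2.
Proof.
move=> uf O0 leO; have D0 := dens_prod_gt0; have k0 := kappa_gt0.
pose good i j := (i != j) && (kappa <= d i j).
pose val i j := \sum_(x in V i) \sum_(y in V j) f x y * w x y.
have val_le i j : val i j <= Q i j by apply: weighted_pair_le.
have X_ge0 v : 0 <= X v by case/andP: (edge_prod_unit gweight_unit S v).
have err0 : 0 <= err by rewrite mulr_ge0 ?ler0n ?ltW.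
have good_le : \sum_i \sum_(j | good i j) val i j <= O + (O + n%:R ^+ 2) * kappa ^+ 2.
  (* Each transversal has value at most [O], and [expect p X] is at most [D + err]. *)
  have avg : \sum_i \sum_(j | good i j) Q i j * expect p (fun v => f (v i) (v j) * X v)
             <= O * (D + err).
    apply: le_trans (_ : O * expect p X <= _); last first.
      by rewrite ler_wpM2l ?expect_edge_prod_le.
    rewrite -expectZ.
    apply: le_trans (le_expect uniform_part_ge0 (F := fun v =>
      \sum_i \sum_(j | good i j) Q i j * (f (v i) (v j) * X v)) _).
      rewrite expect_sum; apply: ler_sum => i _; rewrite expect_sum.
      by apply: ler_sum => j _; rewrite expectZ.
    move=> v; apply: le_trans (ler_wpM2r (X_ge0 v) (leO v)).
    rewrite mulr_suml; apply: ler_sum => i _.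
    rewrite mulr_suml big_mkcond; apply: ler_sum => j _; rewrite mulrA.
    case: ifP => // _; rewrite !mulr_ge0 ?quotient_ge0 //.
    by case/andP: (uf (v i) (v j)).
  (* [dense_edge] bounds the average from below; its error terms, extended to all pairs, add up to
     [n%:R ^+ 2 * err]. *)
  have : D * (\sum_i \sum_(j | good i j) val i j) - n%:R ^+ 2 * err <= O * (D + err).
    apply: le_trans avg; rewrite -sum_part_card2 mulr_sumr mulr_suml -sumrB.
    apply: ler_sum => i _; rewrite mulr_sumr mulr_suml.
    apply: le_trans (_ : \sum_(j | good i j) (D * val i j - sz i * sz j * err) <= _).
      rewrite sumrB lerD2l lerN2 [leLHS]big_mkcond; apply: ler_sum => j _.
      by case: ifP => // _; rewrite mulr_ge0 ?(ltW (sz_gt0 i j)).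
    by apply: ler_sum => j /andP[nij dij]; apply: dense_edge.
  move=> le1; rewrite -(ler_pM2l D0).
  have n0 : 0 <= n%:R ^+ 2 :> R by rewrite exprn_ge0.
  (* By [err_le] the error is at most [kappa ^+ 2] relative to [D], so [D] cancels. *)
  have := ler_wpM2l (addr_ge0 O0 n0) err_le; lra.
(* Each block is good, diagonal or sparse: a diagonal one has value at most [sz i * sz j], a sparse
   one at most [kappa] times that. *)
apply: le_trans (_ : \sum_i \sum_j ((if good i j then val i j else 0) +
   ((if i == j then sz i * sz j else 0) + kappa * (sz i * sz j))) <= _).
  rewrite sum_part2; apply: ler_sum => i _; apply: ler_sum => j _.
  rewrite -/(val i j) /good; have sij := ltW (sz_gt0 i j).
  have ksij : 0 <= kappa * (sz i * sz j) by rewrite mulr_ge0 // ltW.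
  have v1 := val_le i j; have q1 := quotient_le i j.
  case: eqP => [ij|nij] /=.
    by rewrite add0r (le_trans v1) // (le_trans q1) // lerDl.
  case: (leP kappa) => dij /=; first by rewrite add0r lerDl.
  rewrite !add0r (le_trans v1) // quotientE mulrC ler_wpM2r //; exact: ltW.
have split3 (F1 F2 F3 : 'I_k -> 'I_k -> R) :
  \sum_i \sum_j (F1 i j + (F2 i j + F3 i j)) =
  \sum_i \sum_j F1 i j + \sum_i \sum_j F2 i j + \sum_i \sum_j F3 i j.
  by rewrite -!big_split /=; apply: eq_bigr => i _; rewrite -!big_split /=;
     apply: eq_bigr => j _; rewrite addrA.
rewrite split3.
under [X in X + _ + _ <= _]eq_bigr do rewrite -big_mkcond.
have -> : \sum_i \sum_j kappa * (sz i * sz j) = kappa * n%:R ^+ 2.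
  by rewrite -sum_part_card2 mulr_sumr; apply: eq_bigr => i _; rewrite mulr_sumr.
have -> : \sum_i \sum_j (if i == j then sz i * sz j else 0) = \sum_i sz i ^+ 2.
  apply: eq_bigr => i _; rewrite -big_mkcond /= (bigD1 i) //= big1 ?addr0 ?expr2 //.
  by move=> j /andP[/eqP ->]; rewrite eqxx.
by have := sum_sqr_part_card; lra.
Qed.

Lemma sum_quotient_offdiag_ge :
  2 * density R e * n%:R ^+ 2 - 2 * kappa * n%:R ^+ 2 <=
    \sum_i \sum_(j | i != j) Q i j.
Proof.
rewrite -sum_gweight -sum_quotient lerBlDr.
apply: le_trans (lerD (lexx _) sum_sqr_part_card); rewrite -big_split /=.
apply: ler_sum => i _; rewrite (bigD1 i) //= addrC lerD //; last first.
  by rewrite expr2 quotient_le.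
by rewrite le_eqVlt; apply/orP; left; apply/eqP; apply: eq_bigl => j; rewrite eq_sym.
Qed.

End Equitable.
End Partition.

(** Here [N] is the squared vertex count and [kap] is [1/k]. The random cut bounds [M * N * c] by a
    multiple of [O], and [kap] is small against [c * eps0], so the errors sum to at most
    [eps0 * O]. *)
Lemma error_budget (R : realFieldType) (M N O kap c eps0 : R) :
  0 < M -> 0 < N -> 0 <= O -> 0 < kap -> c <= 2^-1 -> 0 < eps0 -> eps0 < 1 ->
  kap <= c / 10 * (eps0 / (1 + eps0)) ->
  M * (2 * c * N - 2 * kap * N) <= 4 * O ->
  M * (O / M + (O / M + N) * kap ^+ 2 + 3 * kap * N) <= (1 + eps0) * O.
Proof.
move=> M0 N0 O0 kap0 c2 e0 e1.
have [r0 r_le r2] : [/\ 0 < eps0 / (1 + eps0), eps0 / (1 + eps0) <= eps0 &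
                      eps0 / (1 + eps0) <= 2^-1].
  have e1' : 0 < 1 + eps0 by rewrite addr_gt0.
  split; first by rewrite divr_gt0.
    by rewrite ler_pdivrMr //; nra.
  by rewrite ler_pdivrMr //; lra.
move: (eps0 / (1 + eps0)) r0 r_le r2 => r r0 r_le r2 k_le.
have c0 : 0 < c by rewrite -(pmulr_lgt0 c r0); lra.
have kr : kap <= r / 20 by nra.
have kap40 : kap <= 40^-1 by lra.
have MN0 : 0 < M * N by rewrite mulr_gt0.
have -> : M * (O / M + (O / M + N) * kap ^+ 2 + 3 * kap * N) =
  O + O * kap ^+ 2 + (M * N * kap) * kap + 3 * (M * N * kap).
  by field; rewrite gt_eqF.
have -> : M * (2 * c * N - 2 * kap * N) = 2 * (M * N * c) - 2 * (M * N * kap) by ring.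
have : M * N * kap <= M * N * c * (r / 10).
  by rewrite -[leRHS]mulrA ler_pM2l //; lra.
have : 0 < M * N * kap by rewrite mulr_gt0.
have : 0 < M * N * c by rewrite mulr_gt0.
move: (M * N * kap) (M * N * c) => Y Z Z0 Y0 YZ cut.
(* This uses [r <= 1/2]; the cut bound [2 * Z - 2 * Y <= 4 * O] then leaves [19/10 * Z <= 4 * O]. *)
have YZ20 : Y <= Z / 20 by nra.
have ZO : Z <= 40 / 19 * O by lra.
have YO : Y <= 4 / 19 * (O * r) by nra.
have Yk : Y * kap <= Y / 40 by rewrite ler_pM2l.
have Ok : O * kap ^+ 2 <= O * r / 20.
  by rewrite -mulrA ler_wpM2l // expr2; nra.
have Or : O * r <= O * eps0 by rewrite ler_wpM2l.
have : 0 <= O * r by rewrite mulr_ge0 // ltW.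
lra.
Qed.

(** * Comparison of the two optima for a fixed target *)

Section Comparison.
Variables (R : realType) (n k : nat) (e : rel 'I_n) (P : 'I_n -> 'I_k) (eps : R).
Hypothesis e_simple : simple_graph e.
Hypothesis P_reg : regular_partition e P eps.
Local Notation w := (gweight R e).
Local Notation Q := (quotient R e P).
Variables (B : finType) (wB : B -> B -> R) (b0 : B).
Hypothesis wB_ge0 : forall a b, 0 <= wB a b.

Lemma opt_quotient_le : opt Q wB <= opt w wB.
Proof.
apply: opt_le => [|h]; first exact: opt_ge0.
by rewrite (quotient_pullback e P (fun i j => wB (h i) (h j))); apply: (le_opt w wB (h \o P)).
Qed.

(** Every part has at most one vertex, so each map on [G] factors through [P]. *)
Lemma opt_le_quotient_small : (n < k)%N -> opt w wB <= opt Q wB.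
Proof.
move=> nk; have P_inj : injective P.
  move=> x y xy; have : (#|part P (P x)| <= 1)%N.
    by case: (P_reg.1 (P x)) => ->; rewrite divn_small //; case: (~~ _).
  by move/card_le1_eqP; apply; rewrite inE ?xy.
apply: opt_le => [|g]; first exact: opt_ge0.
(* On empty parts [b0] is arbitrary: only the values [h (P x)] enter the sum. *)
pose h i := if [pick x | P x == i] is Some x then g x else b0.
have hP x : h (P x) = g x.
  rewrite /h; case: pickP => [y /eqP/P_inj -> //|/(_ x)].
  by rewrite eqxx.
have := le_opt Q wB h; rewrite (quotient_pullback e P (fun i j => wB (h i) (h j))).
by under eq_bigr do under eq_bigr do rewrite !hP.
Qed.

Lemma exists_max_weight : exists a b, forall x y, wB x y <= wB a b.
Proof.
have [[a b] _ le_ab] := arg_maxP (fun q : B * B => wB q.1 q.2) (isT : xpredT (b0, b0)).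
by exists a, b => x y; apply: (le_ab (x, y)).
Qed.

Variable eps0 : R.
Hypothesis eps0_gt0 : 0 < eps0.
Hypothesis eps0_lt1 : eps0 < 1.
Hypothesis eps_gt0 : 0 < eps.
Hypothesis k_gt0 : (0 < k)%N.
Hypothesis k_large : k%:R^-1 <= density R e / 10 * (eps0 / (1 + eps0)).
Hypothesis eps_small : eps <= (k%:R^-1) ^+ (8 * k ^ 2).

Lemma density_le : (0 < n)%N -> density R e <= 2^-1.
Proof.
move=> n0; have n2 : 0 < n%:R ^+ 2 :> R by rewrite exprn_gt0 ?ltr0n.
have : \sum_u \sum_v w u v <= n%:R ^+ 2.
  apply: le_trans (_ : \sum_(u < n) \sum_(v < n) 1 <= _).
    by apply: ler_sum => u _; apply: ler_sum => v _; case/andP: (gweight_unit R e u v).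
  under eq_bigr do rewrite sumr_const card_ord.
  by rewrite sumr_const card_ord -mulrnA -natrX mulnn.
rewrite sum_gweight // -[leRHS]mul1r ler_pM2r //; lra.
Qed.

Lemma opt_le_quotient : opt w wB <= (1 + eps0) * opt Q wB.
Proof.
have O0 := opt_ge0 Q wB; set O := opt Q wB in O0 *.
have [nk|kn] := ltnP n k.
  apply: le_trans (opt_le_quotient_small nk) _; rewrite -/O.
  by rewrite -[leLHS]mul1r ler_wpM2r // lerDl ltW.
have n0 : (0 < n)%N by apply: leq_trans kn.
have [a [b max_ab]] := exists_max_weight; set M := wB a b in max_ab.
apply: opt_le => [|g]; first by rewrite mulr_ge0 // addr_ge0 ?ltW.
have [M0|M0] := leP M 0.
  apply: le_trans (_ : 0 <= _); last by rewrite mulr_ge0 // addr_ge0 ?ltW.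
  apply: sumr_le0 => u _; apply: sumr_le0 => v _.
  rewrite (_ : wB _ _ = 0) ?mulr0 //; apply/le_anti; rewrite wB_ge0 andbT.
  exact: le_trans M0.
(* Dividing by the largest weight brings the values into the unit interval. *)
pose f x y := wB (g x) (g y) / M.
have uf x y : 0 <= f x y <= 1.
  by rewrite /f divr_ge0 ?(ltW M0) //= ler_pdivrMr // mul1r.
have lev (v : 'I_k -> 'I_n) : \sum_i \sum_j Q i j * f (v i) (v j) <= O / M.
  rewrite ler_pdivlMr // mulr_suml.
  apply: le_trans (le_opt Q wB (fun i => g (v i))); apply: ler_sum => i _.
  by rewrite mulr_suml; apply: ler_sum => j _; rewrite /f mulrA divfK // gt_eqF.
have := sum_gweight_le_transversal e_simple P_reg k_gt0 kn eps_small eps_gt0 uf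
  (divr_ge0 O0 (ltW M0)) lev.
rewrite -(ler_pM2l M0).
have -> : M * (\sum_x \sum_y f x y * w x y) = \sum_u \sum_v w u v * wB (g u) (g v).
  rewrite mulr_sumr; apply: eq_bigr => x _; rewrite mulr_sumr; apply: eq_bigr => y _.
  by rewrite /f; field; rewrite gt_eqF.
move/le_trans; apply.
(* The random cut uses the heaviest pair of the target, so that its gain is in units of the same [M]
   as the errors. *)
have cut := opt_ge_cut a b (quotient_ge0 R e P) wB_ge0; rewrite -/M -/O in cut.
have {cut} := le_trans (ler_wpM2l (ltW M0)
  (sum_quotient_offdiag_ge e_simple P_reg k_gt0 kn)) cut.
apply: error_budget => //.
- by rewrite exprn_gt0 ?ltr0n.
- by rewrite invr_gt0 ltr0n.
- exact: density_le.
Qed.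

End Comparison.

(** The value is [ln (a / b)], at most [ln (1 + c)] and so at most [c]; for [b = 0] also [a = 0],
    and the convention for two zeros applies. *)
Lemma lndist_le (R : realType) (a b c : R) : 0 <= b -> 0 <= c ->
  b <= a -> a <= (1 + c) * b -> (lndist a b <= c%:E)%E.
Proof.
move=> b0 c0 ba ab; rewrite /lndist.
have [bz|bz] := eqVneq b 0.
  have -> : a == 0 by rewrite eq_le -{2}bz ba (le_trans ab) // bz mulr0.
  by rewrite lee_fin.
have {}b0 : 0 < b by rewrite lt_neqAle eq_sym bz.
have a0 : 0 < a by apply: lt_le_trans ba.
rewrite gt_eqF //= lee_fin -ln_div ?posrE // ger0_norm; last first.
  by rewrite ln_ge0 // ler_pdivlMr // mul1r.
apply: le_trans (le_ln1Dx _); last by apply: lt_le_trans c0; lra.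
by rewrite ler_ln ?posrE ?divr_gt0 ?ler_pdivrMr // ltr_pwDl.
Qed.

Theorem theorem36 (R : realType) (n k : nat) (e : rel 'I_n)
  (P : 'I_n -> 'I_k) (eps eps0 : R) :
  simple_graph e ->
  0 < eps0 -> eps0 < 1 ->
  0 < eps ->
  regular_partition e P eps ->
  k%:R^-1 <= density R e / 10 * (eps0 / (1 + eps0)) ->
  eps <= (k%:R^-1) ^+ (8 * k ^ 2) ->
  (dopt (gweight R e) (quotient R e P) <= eps0%:E)%E.
Proof.
move=> e_simple e0 e1 eps_gt0 P_reg k_large eps_small.
apply: ge_ereal_sup => _ [m [wC [wC0 ->]]].
have wB0 i j : 0 <= ratr (wC i j) :> R by rewrite ler0q.
apply: lndist_le; rewrite ?opt_ge0 ?(ltW e0) //; first exact: opt_quotient_le.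
(* As [0^-1 = 0], the bounds do not exclude [k = 0]; then [P] has an empty codomain, so [G] has no
   vertices. *)
have [k0|k_gt0] := posnP k; last exact: (opt_le_quotient e_simple P_reg ord0).
apply: opt_le => [|h]; first by rewrite mulr_ge0 ?opt_ge0 // addr_ge0 ?ltW.
rewrite big1 ?mulr_ge0 ?opt_ge0 ?addr_ge0 ?ltW // => u.
by have := ltn_ord (P u); rewrite [X in (_ < X)%N]k0.
Qed.
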